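(* Let $A\in\mathbb{R}^{n\times d}$, let $k\ge 1$ be an integer, let $\epsilon>0$ and set $m=\lceil k/\epsilon\rceil$. Let $\tilde A = A_m$. Then there is a constant $c\ge 0$ (depending only on $A$ and $\tilde A$) such that for every rank $k$ orthogonal projection matrix $P\in\mathbb{R}^{n\times n}$, $$\|A-PA\|_F^2 \le \|\tilde A-P\tilde A\|_F^2 + c \le (1+\epsilon)\,\|A-PA\|_F^2 .$$ That is, $\tilde A$ is a rank $k$ projection-cost preserving sketch of $A$ with one-sided error $\epsilon$.
   Context: For a matrix $A$ with singular value decomposition $A=U\Sigma V^\top$ and an integer $j$, $A_j=U_j\Sigma_jV_j^\top$ denotes the best rank $j$ approximation of $A$ (keeping the $j$ largest singular values; $A_j=A$ if $j\ge \operatorname{rank}(A)$), and $A_{r\setminus j}=A-A_j$. $\|\cdot\|_F$ is the Frobenius norm. A rank $k$ orthogonal projection is a matrix $P=QQ^\top$ where $Q\in\mathbb{R}^{n\times k}$ has orthonormal columns. A matrix $\tilde A\in\mathbb{R}^{n\times d'}$ is a rank $k$ projection-cost preserving sketch of $A$ with one-sided error $\epsilon$ if there is a constant $c\ge 0$, independent of $P$, such that $\|A-PA\|_F^2\le\|\tilde A-P\tilde A\|_F^2+c\le(1+\epsilon)\|A-PA\|_F^2$ for all rank $k$ orthogonal projections $P\in\mathbb{R}^{n\times n}$.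
   Formalization: The formal theorem additionally assumes k ≤ m (automatic when ε ≤ 1); for m < k the claim as stated fails, e.g. k = 2, ε = 2, m = 1, A = diag(1,1,0). *)

(* Defs.v *)
From HB Require Import structures.
From mathcomp Require Import all_boot all_order all_algebra.
From mathcomp Require Import reals.

Set Implicit Arguments.
Unset Strict Implicit.
Unset Printing Implicit Defensive.

Import Order.TTheory GRing.Theory Num.Theory.
Local Open Scope ring_scope.

Definition frobenius (R : realType) (n d : nat) (A : 'M[R]_(n, d)) : R :=
  Num.sqrt (\sum_i \sum_j A i j ^+ 2).

Definition orthonormal_cols (R : realType) (n k : nat) (Q : 'M[R]_(n, k)) :
    Prop :=
  Q^T *m Q = 1%:M.

(* Compact decomposition A = U Sigma V^T, Sigma = diag sigma: only the nonzero
   singular values are kept, so r is necessarily the rank of A. *)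
Definition is_svd (R : realType) (n d r : nat) (A : 'M[R]_(n, d))
    (U : 'M[R]_(n, r)) (sigma : 'rV[R]_r) (V : 'M[R]_(d, r)) : Prop :=
  [/\ orthonormal_cols U, orthonormal_cols V,
      forall i, 0 < sigma 0 i,
      forall i j : 'I_r, (i <= j)%N -> sigma 0 j <= sigma 0 i
    & A = U *m diag_mx sigma *m V^T].

(* The first minn j r columns: all of them when j >= r. *)
Definition first_cols (R : realType) (n r j : nat) (M : 'M[R]_(n, r)) :
    'M[R]_(n, minn j r) :=
  colsub (widen_ord (geq_minr j r)) M.

(* Aj is U_j Sigma_j V_j^T for some singular value decomposition of A.  This is
   a relation because A_j depends on the decomposition when the j-th and
   (j+1)-st singular values coincide. *)
Definition best_rank_approx (R : realType) (n d j : nat)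
    (A Aj : 'M[R]_(n, d)) : Prop :=
  exists r (U : 'M[R]_(n, r)) (sigma : 'rV[R]_r) (V : 'M[R]_(d, r)),
    is_svd A U sigma V /\
    Aj = first_cols j U *m diag_mx (first_cols j sigma) *m (first_cols j V)^T.

Definition rank_orthoproj (R : realType) (n k : nat) (P : 'M[R]_n) : Prop :=
  exists Q : 'M[R]_(n, k), orthonormal_cols Q /\ P = Q *m Q^T.

(* At is a rank k projection-cost preserving sketch of A with one-sided error
   eps, with c as the additive constant; c does not depend on P. *)
Definition pcp_sketch_with (R : realType) (n d d' k : nat) (eps : R)
    (A : 'M[R]_(n, d)) (At : 'M[R]_(n, d')) (c : R) : Prop :=
  forall P : 'M[R]_n, rank_orthoproj k P ->
    frobenius (A - P *m A) ^+ 2 <= frobenius (At - P *m At) ^+ 2 + c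
    /\ frobenius (At - P *m At) ^+ 2 + c
       <= (1 + eps) * frobenius (A - P *m A) ^+ 2.

(* Main.v *)
(* Write A = U diag(s) V^T and put p_j = |Q^T u_j|^2 for P = Q Q^T, so that
   |u_j - P u_j|^2 = 1 - p_j.  By the orthonormality of V, all squared norms
   split over the singular directions: |A - PA|^2 = sum_j s_j^2 (1 - p_j), and
   |At - PAt|^2 is the same sum over j < m.  With c = |A - At|^2, the sum of the
   s_j^2 for j >= m, the sketched cost exceeds |A - PA|^2 by
   sum_(j >= m) s_j^2 p_j.  Bessel's inequality gives p_j <= 1 and
   sum_j p_j <= k.  Comparing every s_j with the m-th one, the claim reduces to
   T <= eps (m - k + T), where T <= k is the sum of the p_j for j >= m: use
   eps m >= k if eps <= 1, and m >= k otherwise. *)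
Require Import Defs.
From HB Require Import structures.
From mathcomp Require Import all_boot all_order all_algebra.
From mathcomp Require Import reals.
From mathcomp Require Import ring lra.

Import Order.TTheory GRing.Theory Num.Theory.
Local Open Scope ring_scope.

Lemma frobenius_sqr (R : realType) (n d : nat) (A : 'M[R]_(n, d)) :
  frobenius A ^+ 2 = \sum_i \sum_j A i j ^+ 2.
Proof.
by rewrite sqr_sqrtr //; do 2!apply: sumr_ge0 => ? _; exact: sqr_ge0.
Qed.

Lemma trmx_mul_diag (R : realType) (n r : nat) (X : 'M[R]_(n, r)) (j : 'I_r) :
  (X^T *m X) j j = \sum_i X i j ^+ 2.
Proof. by rewrite mxE; apply: eq_bigr => i _; rewrite mxE expr2. Qed.

Lemma orthonormal_cols_sqr (R : realType) (n r : nat) (X : 'M[R]_(n, r))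
    (j : 'I_r) :
  orthonormal_cols X -> \sum_i X i j ^+ 2 = 1.
Proof. by move=> oX; rewrite -trmx_mul_diag oX mxE eqxx. Qed.

(** Right multiplication by [V^T] preserves the norm of each row, since [V^T *m V = 1]. *)
Lemma frobenius_sqr_diag (R : realType) (n d r : nat) (X : 'M[R]_(n, r))
    (s : 'rV[R]_r) (V : 'M[R]_(d, r)) :
  orthonormal_cols V ->
  frobenius (X *m diag_mx s *m V^T) ^+ 2 =
  \sum_j s 0 j ^+ 2 * \sum_i X i j ^+ 2.
Proof.
move=> oV; rewrite frobenius_sqr.
under [RHS]eq_bigr do rewrite mulr_sumr.
rewrite [RHS]exchange_big /=; apply: eq_bigr => i _.
set Y := X *m diag_mx s.
have -> : \sum_j (Y *m V^T) i j ^+ 2 = ((Y *m V^T) *m (Y *m V^T)^T) i i.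
  by rewrite [RHS]mxE; apply: eq_bigr => j _; rewrite [_^T j i]mxE expr2.
rewrite trmx_mul trmxK mulmxA -(mulmxA Y) oV mulmx1 mxE.
by apply: eq_bigr => j _; rewrite [Y^T j i]mxE /Y mul_mx_diag mxE; ring.
Qed.

(** Pythagoras: [Q *m Q^T] is symmetric and idempotent, so the Gram matrix of the residual is that
    of [U] minus that of [Q^T *m U]. *)
Lemma residual_col_sqr (R : realType) (n k r : nat) (Q : 'M[R]_(n, k))
    (U : 'M[R]_(n, r)) (j : 'I_r) :
  orthonormal_cols Q -> orthonormal_cols U ->
  \sum_i (U - Q *m Q^T *m U) i j ^+ 2 = 1 - \sum_a (Q^T *m U) a j ^+ 2.
Proof.
move=> oQ oU; rewrite -!trmx_mul_diag.
have -> : (U - Q *m Q^T *m U)^T *m (U - Q *m Q^T *m U) =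
    1%:M - (Q^T *m U)^T *m (Q^T *m U).
  rewrite [(U - _)^T]linearB /= !trmx_mul !trmxK mulmxBl !mulmxBr oU -!mulmxA.
  by rewrite [Q^T *m (Q *m _)]mulmxA oQ mul1mx subrr subr0.
by rewrite mxE [X in _ + X]mxE [1%:M j j]mxE eqxx.
Qed.

Lemma bessel_cols (R : realType) (n k r : nat) (Q : 'M[R]_(n, k))
    (U : 'M[R]_(n, r)) (j : 'I_r) :
  orthonormal_cols Q -> orthonormal_cols U ->
  \sum_a (Q^T *m U) a j ^+ 2 <= 1.
Proof.
move=> oQ oU; rewrite -subr_ge0 -residual_col_sqr //.
by apply: sumr_ge0 => i _; exact: sqr_ge0.
Qed.

(** After exchanging the sums, Bessel is applied with [Q] and [U] swapped: each of the [k] columns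
    of [Q] contributes at most 1. *)
Lemma bessel_sum (R : realType) (n k r : nat) (Q : 'M[R]_(n, k))
    (U : 'M[R]_(n, r)) :
  orthonormal_cols Q -> orthonormal_cols U ->
  \sum_j \sum_a (Q^T *m U) a j ^+ 2 <= k%:R.
Proof.
move=> oQ oU; rewrite exchange_big /=.
have -> : k%:R = \sum_(a < k) (1 : R) by rewrite sumr_const card_ord.
apply: ler_sum => a _; apply: le_trans (@bessel_cols _ _ _ _ U Q a oU oQ).
have -> : U^T *m Q = (Q^T *m U)^T by rewrite trmx_mul trmxK.
by under [leRHS]eq_bigr do rewrite [_^T _ _]mxE.
Qed.

(** Zero padding keeps the length [r], so a matrix and its truncation share the factors [U] and [V]
    and can be subtracted inside [diag_mx]. *)
Definition truncate_row {R : realType} {r : nat} (m : nat) (s : 'rV[R]_r) :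
    'rV[R]_r :=
  \row_j (if (j < m)%N then s 0 j else 0).

Lemma first_cols_truncate (R : realType) (n d r m : nat) (U : 'M[R]_(n, r))
    (s : 'rV[R]_r) (V : 'M[R]_(d, r)) :
  first_cols m U *m diag_mx (first_cols m s) *m (first_cols m V)^T =
  U *m diag_mx (truncate_row m s) *m V^T.
Proof.
apply/matrixP => i j; rewrite !mul_mx_diag !mxE.
under [RHS]eq_bigr do rewrite !mxE.
rewrite (bigID (fun l : 'I_r => (l < minn m r)%N)) /= [X in _ + X]big1 ?addr0.
  rewrite (big_ord_narrow (geq_minr m r)); apply: eq_bigr => l _.
  by rewrite !mxE /= (leq_trans (ltn_ord l) (geq_minl m r)).
by move=> l; rewrite leq_min ltn_ord andbT => /negbTE ->; rewrite mulr0 mul0r.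
Qed.

Lemma weighted_tail_le (R : realType) (r k m : nat) (eps : R)
    (w p : 'I_r -> R) :
  (forall j, 0 <= w j) -> (forall i j : 'I_r, (i <= j)%N -> w j <= w i) ->
  (forall j, 0 <= p j) -> (forall j, p j <= 1) -> \sum_j p j <= k%:R ->
  0 < eps -> k%:R <= eps * m%:R -> (k <= m)%N ->
  \sum_(j < r | ~~ (j < m)%N) w j * p j <= eps * \sum_j w j * (1 - p j).
Proof.
move=> w0 wD p0 p1 pk eps0 km lekm.
have q0 j : 0 <= w j * (1 - p j) by rewrite mulr_ge0 ?subr_ge0.
have [rm|mr] := leqP r m.
  rewrite big1 => [|j]; first by apply: mulr_ge0; [exact: ltW | exact: sumr_ge0].
  by rewrite (leq_trans (ltn_ord j) rm).
(* Indices start at 0, so this is the largest discarded weight; it bounds the tail weights from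
   above and the kept ones from below. *)
pose s := w (Ordinal mr).
set T := \sum_(j < r | ~~ (j < m)%N) p j.
have leT : \sum_(j < r | ~~ (j < m)%N) w j * p j <= s * T.
  rewrite mulr_sumr; apply: ler_sum => j; rewrite -leqNgt => mj.
  by rewrite ler_wpM2r // wD.
have pE : \sum_j p j = \sum_(j < r | (j < m)%N) p j + T.
  by rewrite (bigID (fun j : 'I_r => (j < m)%N)).
(* Drop the nonnegative tail; as [m < r], exactly [m] indices remain. *)
have geH : s * (m%:R - \sum_(j < r | (j < m)%N) p j) <=
    \sum_j w j * (1 - p j).
  rewrite [leRHS](bigID (fun j : 'I_r => (j < m)%N)) /=.
  apply: ler_wpDr; first exact: sumr_ge0.
  have -> : m%:R = \sum_(j < r | (j < m)%N) (1 : R).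
    by rewrite (big_ord_narrow (ltnW mr)) sumr_const card_ord.
  rewrite -sumrB mulr_sumr; apply: ler_sum => j jm.
  by rewrite ler_wpM2r ?subr_ge0 // wD // ltnW.
apply: le_trans leT _; apply: le_trans (ler_wpM2l (ltW eps0) geH).
rewrite mulrCA; apply: ler_wpM2l; first exact: w0.
have T0 : 0 <= T by exact: sumr_ge0.
have H0 : 0 <= \sum_(j < r | (j < m)%N) p j by exact: sumr_ge0.
have kmR : k%:R <= m%:R :> R by rewrite ler_nat.
move: pk; rewrite pE; set H := \sum_(j < r | _) _ in H0 *; move=> HTk.
have bound : eps * (m%:R - k%:R + T) <= eps * (m%:R - H).
  by rewrite ler_pM2l //; lra.
apply: le_trans bound.
(* If [eps <= 1], then [eps * m >= k] leaves a surplus of at least [(1 - eps) * (k - T)]; otherwise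
   the surplus is [eps * (m - k) + (eps - 1) * T]. *)
have [e1|e1] := lerP eps 1.
  have : 0 <= (1 - eps) * (k%:R - T) by apply: mulr_ge0; lra.
  lra.
have : 0 <= (eps - 1) * T by apply: mulr_ge0; lra.
have : 0 <= eps * (m%:R - k%:R) by rewrite pmulr_rge0 //; lra.
lra.
Qed.

(* k <= m holds whenever eps <= 1; for larger eps with m < k the claim fails,
   e.g. k = 2, eps = 2, m = 1, A = diag(1, 1, 0). *)
Theorem theorem7 (R : realType) (n d : nat) (A At : 'M[R]_(n, d)) :
  exists c : R, 0 <= c /\
    forall (k m : nat) (eps : R),
      (1 <= k)%N -> 0 < eps -> m%:Z = Num.ceil (k%:R / eps) -> (k <= m)%N ->
      best_rank_approx m A At ->
      pcp_sketch_with k eps A At c.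
Proof.
exists (frobenius (A - At) ^+ 2); split; first exact: sqr_ge0.
move=> k m eps _ eps0 mE lekm [r [U [s [V [[oU oV s0 sD AE] AtE]]]]].
move=> _ [Q [oQ ->]].
have km : k%:R <= eps * m%:R.
  by rewrite mulrC -ler_pdivrMr // -[m%:R]/(m%:Z%:~R) mE ceil_ge.
pose p (j : 'I_r) := \sum_a (Q^T *m U) a j ^+ 2.
have p0 j : 0 <= p j by apply: sumr_ge0 => a _; exact: sqr_ge0.
(* Stated for any diagonal [t], to serve both [A] and [At]. *)
have residE t : frobenius (U *m diag_mx t *m V^T -
    Q *m Q^T *m (U *m diag_mx t *m V^T)) ^+ 2 = \sum_j t 0 j ^+ 2 * (1 - p j).
  rewrite !mulmxA -!mulmxBl frobenius_sqr_diag //.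
  by apply: eq_bigr => j _; rewrite residual_col_sqr.
have costA := residE s; have costAt := residE (truncate_row m s).
rewrite -AE in costA; rewrite -first_cols_truncate -AtE in costAt.
have cE : frobenius (A - At) ^+ 2 = \sum_(j < r | ~~ (j < m)%N) s 0 j ^+ 2.
  rewrite AE AtE first_cols_truncate -mulmxBl -mulmxBr -linearB /=.
  rewrite frobenius_sqr_diag // (bigID (fun j : 'I_r => (j < m)%N)) /=.
  rewrite big1 ?add0r => [|j jm]; last by rewrite !mxE jm subrr expr0n mul0r.
  apply: eq_bigr => j /negbTE jm.
  by rewrite orthonormal_cols_sqr // !mxE jm subr0 mulr1.
(* Kept terms agree on both sides; for a discarded index, [s_j^2 = s_j^2 (1 - p_j) + s_j^2 p_j]. *)
have excess : frobenius (At - Q *m Q^T *m At) ^+ 2 + frobenius (A - At) ^+ 2 =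
    frobenius (A - Q *m Q^T *m A) ^+ 2 +
    \sum_(j < r | ~~ (j < m)%N) s 0 j ^+ 2 * p j.
  rewrite costA costAt cE !(bigID (fun j : 'I_r => (j < m)%N) predT) /=.
  rewrite [X in _ + X + _ = _]big1 ?addr0 => [|j /negbTE jm]; last first.
    by rewrite mxE jm expr0n mul0r.
  rewrite -addrA -big_split /=; congr (_ + _).
    by apply: eq_bigr => j jm; rewrite mxE jm.
  by apply: eq_bigr => j _; ring.
rewrite excess; split.
  by rewrite lerDl; apply: sumr_ge0 => j _; rewrite mulr_ge0 ?sqr_ge0.
rewrite mulrDl mul1r lerD2l costA.
apply: (@weighted_tail_le _ _ k) => //.
- by move=> j; exact: sqr_ge0.
- move=> i j ij.
  by rewrite ler_sqr ?nnegrE; [exact: sD | exact: ltW | exact: ltW].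
- by move=> j; exact: bessel_cols.
- exact: bessel_sum.
Qed.
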